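(* Let $t\ge1$, let $d_1,\dots,d_t$ be positive integers and $h_1,\dots,h_t$ nonnegative integers, put $n=\sum_{i=1}^t d_i$, and assume $h_1+\cdots+h_t\le n$. Let $B=B(h_1,d_1;\dots;h_t,d_t)$ be the Ferrers board in the $n\times n$ grid whose first $d_1$ columns have height $h_1$, whose next $d_2$ columns have height $h_1+h_2$, and so on, the last $d_t$ columns having height $h_1+\cdots+h_t$. Then $\xi(\,\cdot\,,B)$ is multiset Mahonian, i.e., with $\mathbf d=(d_1,\dots,d_t)$, $$\sum_{\sigma\in M(\mathbf d)} q^{\xi(\sigma,B)}=\frac{[n]!}{\prod_{i=1}^t[d_i]!}.$$
   Context: $[m]=(1-q^m)/(1-q)$, $[m]!=\prod_{i=1}^m[i]$. Squares of the $n\times n$ grid are labelled $(i,j)$ = (row, column) as for a matrix (row $1$ at the top, column $1$ at the left). A column of a Ferrers board of height $c$ consists of the top $c$ squares of that column. $M(\mathbf d)$ is the set of permutations (linear arrangements) $\sigma=\sigma_1\cdots\sigma_n$ of the multiset $\{1^{d_1}2^{d_2}\cdots t^{d_t}\}$. Non-attacking means no two rooks share a row or a column. For a placement $C$ of $n$ non-attacking rooks on the $n\times n$ grid, $\xi(C,B)$ (Dworkin's statistic) is computed as follows. Call a cell empty if it contains no rook and is not to the right of a rook (in the same row). For each rook on $B$, place a circle in the empty cells of $B$ that are below it in its column. For each rook off $B$, place a circle in the empty cells below it in its column, and also in the empty cells of $B$ above it in its column. Then $\xi(C,B)$ is the number of circles. A section $D$ of $B$ of width $d$ is a set of $d$ consecutive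 columns of the grid in which all columns of $B$ have the same height. If $s$ of the $d$ rooks of $C$ in $D$ are on $B$, then $C$ is $D$-regular if: (1) the $s$ rooks in $D$ on $B$ are in the $s$ left-most columns of $D$ and are in ascending order: if two of them occupy $(i,j)$ and $(k,l)$ with $i<k$, then $j>l$; and (2) the $d-s$ remaining rooks in $D$, off $B$, are also in ascending order. Let block $j$ be the set of columns $d_1+\cdots+d_{j-1}+1,\dots,d_1+\cdots+d_j$. For $\sigma\in M(\mathbf d)$, the $B$-regular graph $P(\sigma)$ is the unique placement of $n$ non-attacking rooks on the $n\times n$ grid such that for each $i$ the rook in row $i$ lies in block $\sigma_i$, and which is $D$-regular for $D$ equal to each of the $t$ blocks. Define $\xi(\sigma,B)=\xi(P(\sigma),B)$. *)

(* Defs.v *)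
From HB Require Import structures.
From mathcomp Require Import all_boot all_order all_fingroup all_algebra.

Set Implicit Arguments.
Unset Strict Implicit.
Unset Printing Implicit Defensive.

Import GRing.Theory.

Local Open Scope nat_scope.

(* Rows and columns are numbered from 0. The square x : 'I_n * 'I_n lies in
   row x.1 (0 is the top row) and column x.2 (0 is the leftmost column).
   A placement of n non-attacking rooks on the n x n grid is a permutation
   C : 'S_n, whose rook in row i is in column C i; the rook of column j is
   therefore in row C^-1 j. *)

Section Placements.

Variable n : nat.
Implicit Types (C : 'S_n) (B : {set 'I_n * 'I_n}) (D : {set 'I_n}).

Definition rook_on B C (i : 'I_n) : bool := (i, C i) \in B.

Definition empty_cell C (x : 'I_n * 'I_n) : bool :=
  (x.2 != C x.1) && ~~ (C x.1 < x.2).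

(* A column contains exactly one rook, so no cell receives two circles. *)
Definition circled B C (x : 'I_n * 'I_n) : bool :=
  let r := (C^-1)%g x.2 in
  empty_cell C x &&
  (if rook_on B C r then (x \in B) && (r < x.1)
   else (r < x.1) || ((x \in B) && (x.1 < r))).

Definition xi B C : nat := #|[set x | circled B C x]|.

(* D is the set of columns of a section of B. The column j of D is among the
   s leftmost ones when fewer than s columns of D lie to its left. *)
Definition regular B D C : bool :=
  let s := #|[set i | (C i \in D) && rook_on B C i]| in
  [&& [forall i, (C i \in D) && rook_on B C i ==>
         (#|[set j in D | j < C i]| < s)],
      [forall i, forall k,
         [&& C i \in D, rook_on B C i, C k \in D, rook_on B C k & i < k] ==>
         (C k < C i)]
    & [forall i, forall k,
         [&& C i \in D, ~~ rook_on B C i, C k \in D, ~~ rook_on B C k & i < k]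
         ==> (C k < C i)]].

End Placements.

Section Words.

Variables (n t : nat) (d : 'I_t -> nat).
Implicit Types (k : 'I_t) (sigma : n.-tuple 'I_t).

Definition block k : {set 'I_n} :=
  [set j : 'I_n | \sum_(l < t | l < k) d l <= j < \sum_(l < t | l <= k) d l].

Definition ferrers_board (h : 'I_t -> nat) : {set 'I_n * 'I_n} :=
  [set x : 'I_n * 'I_n | [exists k, (x.2 \in block k)
                      && (x.1 < \sum_(l < t | l <= k) h l)]].

Definition multiset_perms : {set n.-tuple 'I_t} :=
  [set sigma : n.-tuple 'I_t | [forall k, count_mem k sigma == d k]].

Definition is_regular_graph (B : {set 'I_n * 'I_n}) sigma (C : 'S_n) : bool :=
  [forall i, C i \in block (tnth sigma i)]
  && [forall k, regular B (block k) C].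

(* P(sigma). The default value 1 is never used for a multiset permutation
   sigma and a Ferrers board: see [regular_graphP] and [regular_graph_uniq]. *)
Definition regular_graph (B : {set 'I_n * 'I_n}) sigma : 'S_n :=
  odflt 1%g [pick C | is_regular_graph B sigma C].

Definition xi_word (B : {set 'I_n * 'I_n}) sigma : nat :=
  xi B (regular_graph B sigma).

End Words.

Section RegularGraph.

Variables (n t : nat) (d h : 'I_t -> nat).
Hypothesis nE : n = \sum_(i < t) d i.

Notation B := (ferrers_board n d h).
Let off (k : 'I_t) := \sum_(l < t | l < k) d l.
Let ht (k : 'I_t) := \sum_(l < t | l <= k) h l.

Lemma off_next (k : 'I_t) : \sum_(l < t | l <= k) d l = off k + d k.
Proof.
rewrite (bigD1 k) //= addnC; congr (_ + _); apply: eq_bigl => l.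
by rewrite ltn_neqAle andbC.
Qed.

Lemma in_block k (j : 'I_n) : (j \in block n d k) = (off k <= j < off k + d k).
Proof. by rewrite inE off_next. Qed.

Lemma off_mono (k l : 'I_t) : k < l -> off k + d k <= off l.
Proof.
move=> kl; rewrite -off_next /off [X in _ <= X](bigID (fun i : 'I_t => i <= k)) /=.
rewrite (eq_bigl (fun i : 'I_t => (i < l) && (i <= k))) ?leq_addr // => i.
by case: (leqP i k) => ik; rewrite ?andbF ?andbT //; apply/esym/(leq_ltn_trans ik).
Qed.

Lemma off_bound k : off k + d k <= n.
Proof.
rewrite -off_next nE [X in _ <= X](bigID (fun i : 'I_t => i <= k)) /=.
exact: leq_addr.
Qed.

Lemma block_inj k l x :
  off k <= x < off k + d k -> off l <= x < off l + d l -> k = l.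
Proof.
move=> /andP[k1 k2] /andP[l1 l2]; apply: val_inj => /=.
case: (ltngtP k l) => // /off_mono le.
  by move: (leq_trans (leq_trans k2 le) l1); rewrite ltnn.
by move: (leq_trans (leq_trans l2 le) k1); rewrite ltnn.
Qed.

Lemma on_board k (i j : 'I_n) : j \in block n d k -> ((i, j) \in B) = (i < ht k).
Proof.
move=> jk; rewrite inE /=; apply/existsP/idP => [[l /andP[jl]]|ik]; last first.
  by exists k; rewrite jk.
by move: jk jl; rewrite !in_block => jk jl; rewrite (block_inj jk jl).
Qed.

Section Word.

Variable sigma : n.-tuple 'I_t.
Hypothesis sigma_perm : sigma \in multiset_perms n d.

Notation w := (tnth sigma).
Let on (i : 'I_n) := i < ht (w i).
Let left_of (i i' : 'I_n) := if on i == on i' then i' < i else on i.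
Let lefts (i : 'I_n) := [set i' | (w i' == w i) && left_of i' i].
Let pos (i : 'I_n) := off (w i) + #|lefts i|.

Lemma card_rows k : #|[set i | w i == k]| = d k.
Proof.
move: sigma_perm; rewrite inE => /forallP/(_ k)/eqP <-.
rewrite cardsE -sum1_card -sum1_count big_tuple.
by apply: eq_bigl => i; rewrite inE.
Qed.

Lemma left_ofxx i : left_of i i = false.
Proof. by rewrite /left_of eqxx ltnn. Qed.

Lemma left_of_trans i j k : left_of i j -> left_of j k -> left_of i k.
Proof.
rewrite /left_of; case: (on i) (on j) (on k) => [] [] [] //= ij jk.
  exact: ltn_trans jk ij.
exact: ltn_trans jk ij.
Qed.

Lemma left_of_total i j : i != j -> left_of i j || left_of j i.
Proof.
rewrite /left_of -val_eqE neq_ltn [on j == _]eq_sym orbC.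
by case: (on i) (on j) => [] [].
Qed.

Lemma lefts_proper i j : w i = w j -> left_of i j -> #|lefts i| < #|lefts j|.
Proof.
move=> wij ij; apply: proper_card; apply/properP; split.
  apply/subsetP=> k; rewrite !inE wij => /andP[-> ki] /=.
  exact: left_of_trans ki ij.
by exists i; rewrite inE ?wij ?eqxx ?left_ofxx ?andbF.
Qed.

Lemma pos_bounds i : off (w i) <= pos i < off (w i) + d (w i).
Proof.
rewrite leq_addr ltn_add2l -card_rows; apply: proper_card.
apply/properP; split; first by apply/subsetP=> k; rewrite !inE => /andP[].
by exists i; rewrite inE ?eqxx // left_ofxx andbF.
Qed.

Lemma pos_lt i : pos i < n.
Proof. by case/andP: (pos_bounds i) => _ /leq_trans; apply; apply: off_bound. Qed.

Lemma pos_mono i j : w i = w j -> left_of i j -> pos i < pos j.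
Proof. by move=> wij ij; rewrite /pos wij ltn_add2l lefts_proper. Qed.

Lemma pos_inj : injective (fun i => Ordinal (pos_lt i)).
Proof.
move=> i j /(congr1 val) /= pij.
have wij : w i = w j.
  by apply: (block_inj (pos_bounds i)); rewrite pij; apply: pos_bounds.
apply/eqP; apply: contraTT isT => /left_of_total /orP[] lt.
  by move: (pos_mono wij lt); rewrite pij ltnn.
by move: (pos_mono (esym wij) lt); rewrite pij ltnn.
Qed.

Lemma rook_onE (C : 'S_n) i :
  C i \in block n d (w i) -> rook_on B C i = on i.
Proof. exact: on_board. Qed.

Lemma rook_blockE (C : 'S_n) :
  (forall i, C i \in block n d (w i)) ->
  forall i k, (C i \in block n d k) = (w i == k).
Proof.
move=> Cb i k; apply/idP/eqP => [ik | <- //].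
by apply: (@block_inj _ _ (C i)); rewrite -in_block.
Qed.

Lemma card_block_left (C : 'S_n) i :
  (forall i, C i \in block n d (w i)) ->
  #|[set j in block n d (w i) | j < C i]|
    = #|[set i' | (w i' == w i) && (C i' < C i)]|.
Proof.
move=> Cb; rewrite -[RHS](card_imset _ (@perm_inj _ C)).
apply: eq_card => j.
rewrite -(permKV C j) mem_imset; last exact: perm_inj.
by rewrite in_set [RHS]in_set -(rook_blockE Cb).
Qed.

Lemma regular_graphP :
  is_regular_graph d B sigma (regular_graph d B sigma).
Proof.
rewrite /regular_graph; case: pickP => [C //|noC] /=.
pose C := perm pos_inj; move: (noC C) => /negP[].
have Cb i : C i \in block n d (w i) by rewrite in_block permE; apply: pos_bounds.
apply/andP; split; first exact/forallP.
apply/forallP=> k; apply/and3P; split.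
- apply/forallP=> i; apply/implyP => /andP[]; rewrite rook_blockE // => /eqP <-.
  rewrite rook_onE // => oni; rewrite card_block_left //.
  apply: proper_card; apply/properP; split; last first.
    by exists i; rewrite in_set ?ltnn ?andbF // Cb rook_onE.
  apply/subsetP=> i'; rewrite in_set => /andP[/eqP wi].
  rewrite in_set -wi Cb rook_onE // !permE /= => lt; apply: contraTT lt => noni'.
  by rewrite -leqNgt ltnW // pos_mono // /left_of oni (negbTE noni').
- apply/forallP=> i; apply/forallP=> l; apply/implyP=> /and5P[].
  rewrite !rook_blockE // !rook_onE // => /eqP wi oni /eqP wl onl il.
  by rewrite !permE; apply: pos_mono; rewrite ?wi // /left_of oni onl.
- apply/forallP=> i; apply/forallP=> l; apply/implyP=> /and5P[].
  rewrite !rook_blockE // !rook_onE // => /eqP wi oni /eqP wl onl il.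
  by rewrite !permE; apply: pos_mono; rewrite ?wi // /left_of (negbTE oni) (negbTE onl).
Qed.

Lemma regular_mono (C : 'S_n) i j :
  is_regular_graph d B sigma C -> w i = w j -> left_of i j -> C i < C j.
Proof.
case/andP=> /forallP Cb /forallP/(_ (w i))/and3P[R0 R1 R2] wij.
have mono x y : w x = w i -> w y = w i -> on x = on y -> y < x -> C x < C y.
  move=> wx wy oxy yx.
  case ox: (on x).
    move/forallP/(_ y)/forallP/(_ x)/implyP: R1; apply.
    by rewrite !rook_blockE // !rook_onE // wx wy eqxx -oxy ox.
  move/forallP/(_ y)/forallP/(_ x)/implyP: R2; apply.
  by rewrite !rook_blockE // !rook_onE // wx wy eqxx -oxy ox.
rewrite /left_of; case: eqP => [oij ji|noij oi]; first exact: mono.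
have oj : on j = false by apply/negP=> oj; apply: noij; rewrite oi oj.
rewrite ltnNge; apply/negP=> Cji.
have {}Cji : C j < C i.
  rewrite ltn_neqAle Cji andbT; apply/eqP=> /val_inj/perm_inj ji.
  by rewrite ji oi in oj.
pose S := [set x | (w x == w i) && on x].
have Sne : i \in S by rewrite inE eqxx.
case: (arg_maxnP (fun x => val (C x)) Sne) => m mS mmax.
have [wm om] : w m = w i /\ on m by case/setIdP: mS => /eqP.
have Cjm : C j < C m by apply: leq_trans Cji (mmax i Sne).
have := forallP R0 m; rewrite rook_blockE // rook_onE // wm eqxx om /=.
rewrite -wm card_block_left // wm.
have -> : [set i0 | (C i0 \in block n d (w i)) && rook_on B C i0] = S.
  apply: eq_finset => x; rewrite rook_blockE //.
  by case: eqP => //= wx; rewrite rook_onE.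
have jS : j \notin S :\ m by rewrite in_setD1 in_set oj !andbF.
have -> : #|S| = #|j |: (S :\ m)|.
  by rewrite cardsU1 jS (cardsD1 m S) (_ : m \in S).
apply/negP; rewrite -leqNgt; apply/subset_leq_card/subsetP=> x.
case/setU1P=> [-> | /setD1P[xm /[dup] xS /setIdP[wx _]]].
  by rewrite in_set wij eqxx.
rewrite in_set wx /= ltn_neqAle (mmax x xS : _ <= _) andbT.
by apply: contraNneq xm => /val_inj/perm_inj->.
Qed.

Lemma regular_graph_uniq (C : 'S_n) :
  is_regular_graph d B sigma C -> C = regular_graph d B sigma.
Proof.
suff posE C' : is_regular_graph d B sigma C' -> forall i, C' i = pos i :> nat.
  move=> CP; apply/permP=> i; apply: val_inj => /=.
  by rewrite (posE _ CP) (posE _ regular_graphP).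
move=> CP i; have /andP[/forallP Cb _] := CP.
have /andP[le lt] : off (w i) <= C' i < off (w i) + d (w i).
  by rewrite -in_block.
rewrite /pos -(subnKC le); congr (_ + _).
have -> : #|lefts i| = #|[set j in block n d (w i) | j < C' i]|.
  rewrite card_block_left //; rewrite /lefts; congr #|pred_of_set _|; apply: eq_finset => x.
  case: eqP => //= wx; apply/idP/idP; first exact: regular_mono.
  case: (eqVneq x i) => [->|/left_of_total/orP[//|ix]]; first by rewrite ltnn.
  by move/ltn_trans/(_ (regular_mono CP (esym wx) ix)); rewrite ltnn.
rewrite cardE -(size_map val) -(size_iota (off (w i)) (C' i - off (w i))).
apply/eqP; rewrite -uniq_size_uniq ?iota_uniq //.
- by rewrite map_inj_uniq ?enum_uniq //; apply: val_inj.
- move=> x; rewrite mem_iota subnKC //; apply/mapP/idP.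
    case=> y; rewrite mem_enum in_set in_block => /andP[/andP[ly _] lty] ->.
    by rewrite ly.
  case/andP=> lex ltx.
  have xn : x < n by apply: ltn_trans ltx (ltn_ord _).
  exists (Ordinal xn) => //; rewrite mem_enum in_set in_block /= lex ltx.
  by rewrite (ltn_trans ltx lt).
Qed.

End Word.
End RegularGraph.

Section QAnalogues.

Local Open Scope ring_scope.

Variables (F : fieldType) (q : F).

Definition qint (m : nat) : F := (1 - q ^+ m) / (1 - q).

Definition qfact (m : nat) : F := \prod_(1 <= i < m.+1) qint i.

End QAnalogues.

(* The indeterminate q of the field Q(q) of rational functions. *)
Definition qvar : {fraction {poly rat}} := tofrac ('X : {poly rat})%R.

(* Main.v *)
(* Read the rows of a column of height c in the cyclic order
   c-1, ..., 0, n-1, ..., c. The circles of a column are the cells, with rook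
   further to the right, that precede the rook of the column in this order; and
   a regular graph places the rooks of a block in increasing order. So
   xi(sigma, B) counts the pairs of rows (i, j) such that sigma_i < sigma_j and j
   precedes i in the order of block sigma_i. The orders of the different blocks
   need not be related: choosing successively the rows of the letters 1, 2, ...
   among the remaining rows contributes a factor [m choose d_k] at each step. *)
Require Import Defs.
From mathcomp Require Import all_boot all_order all_fingroup all_algebra.
From mathcomp Require Import zify ring.

Set Implicit Arguments.
Unset Strict Implicit.
Unset Printing Implicit Defensive.

Import GRing.Theory.

Local Open Scope ring_scope.

(** * Gaussian binomial coefficients *)

Section QBinomial.

Variables (F : fieldType) (q : F).

Lemma qint0 : qint q 0 = 0.
Proof. by rewrite /qint expr0 subrr mul0r. Qed.

Lemma qintD a b : qint q (a + b) = qint q a + q ^+ a * qint q b.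
Proof. by rewrite /qint exprD mulrA -mulrDl; congr (_ / _); ring. Qed.

Lemma qfact0 : qfact q 0 = 1.
Proof. by rewrite /qfact big_nil. Qed.

Lemma qfactS m : qfact q m.+1 = qfact q m * qint q m.+1.
Proof. by rewrite /qfact big_nat_recr. Qed.

(** The Gaussian binomial, by the Pascal recursion and without division. The power of [q] goes with
    choosing the greatest of [m'.+1] elements, which then exceeds the [m' - d'] elements left
    out. *)
Fixpoint qbinom (m d : nat) : F :=
  match m, d with
  | _, 0 => 1
  | 0, _.+1 => 0
  | m'.+1, d'.+1 => q ^+ (m' - d') * qbinom m' d' + qbinom m' d
  end.

Lemma qbinom0r m : qbinom m 0 = 1.
Proof. by case: m. Qed.

Lemma qbinom_small m d : (m < d)%N -> qbinom m d = 0.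
Proof.
elim: m d => [|m IH] [|d] //= md.
by rewrite !IH ?mulr0 ?addr0 // ltnW.
Qed.

(** The product form holds for every [q], even where a factorial vanishes. Splitting [[m+1]] as
    [[m-d] + q^(m-d) [d+1]] matches the two terms of the recursion. *)
Lemma qbinom_fact m d : (d <= m)%N ->
  qbinom m d * (qfact q d * qfact q (m - d)) = qfact q m.
Proof.
elim: m d => [|m IH] [|d] // dm.
- by rewrite qfact0 qbinom0r !mul1r.
- by rewrite qbinom0r qfact0 subn0 !mul1r.
rewrite ltnS in dm; rewrite [qbinom _ _]/= subSS [RHS]qfactS qfactS.
have -> : qint q m.+1 = qint q (m - d) + q ^+ (m - d) * qint q d.+1.
  by rewrite -qintD addnS subnK.
rewrite mulrDl mulrDr addrC; congr (_ + _); last by rewrite -(IH _ dm); ring.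
case: (ltnP d m) => [lt_dm|le_md].
  by rewrite -(IH _ lt_dm) -[in LHS](subnSK lt_dm) !qfactS -(subnSK lt_dm); ring.
(* Here [d = m], and both sides vanish: the left through [qbinom m m.+1], the right through
   [[0]]. *)
have -> : (m - d = 0)%N by apply/eqP.
by rewrite qbinom_small // mul0r qint0 mulr0.
Qed.

End QBinomial.

(** * Inversions between a subset and its complement *)

Section SubsetInversions.

Variables (F : fieldType) (q : F) (T : finType).
Implicit Types (S U A : {set T}) (rho : T -> nat).

Definition cross rho S U : nat :=
  (\sum_(i in S) #|[set j in U | rho j < rho i]|)%N.

(** Induction on [#|A|], removing the element [z] of largest [rho]: it is inverted with every
    unchosen element if chosen, and with none otherwise, which is the recursion of [qbinom]. *)
Lemma sum_cross rho A d : injective rho ->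
  \sum_(S : {set T} | (S \subset A) && (#|S| == d)) q ^+ cross rho S (A :\: S)
  = qbinom q #|A| d.
Proof.
move=> rho_inj; move mE : #|A| => m; elim: m => [|m IH] in A d mE *.
  move/eqP: mE; rewrite cards_eq0 => /eqP ->.
  case: d => [|d]; last first.
    rewrite big_pred0 // => S; rewrite subset0.
    by case: (eqVneq S set0) => [->|//]; rewrite cards0.
  rewrite (big_pred1 set0) => [|S]; first by rewrite /cross big_set0.
  by rewrite /= subset0; case: (eqVneq S set0) => [->|//]; rewrite cards0.
case: d => [|d].
  rewrite (big_pred1 set0) => [|S]; first by rewrite /cross big_set0.
  by rewrite /= cards_eq0 andbC; case: (eqVneq S set0) => [->|//]; rewrite sub0set.
have [y yA] : exists y, y \in A by apply/card_gt0P; rewrite mE.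
case: (@arg_maxnP _ y (mem A) rho yA) => z zA zmax; rewrite inE in zA.
have {}zmax i : i \in A -> (rho i <= rho z)%N := zmax i.
have ltz j : j \in A -> j != z -> (rho j < rho z)%N.
  by move=> jA; rewrite ltn_neqAle (inj_eq rho_inj) => -> /=; apply: zmax.
have cardAz : #|A :\ z| = m by move: mE; rewrite (cardsD1 z) zA => -[].
rewrite (bigID (fun S => z \in S)) /=; congr (_ + _).
  rewrite (reindex_onto (fun S => z |: S) (fun S => S :\ z)) /=; last first.
    by move=> S /andP[_ zS]; rewrite setD1K.
  rewrite -(IH (A :\ z)) // big_distrr /=; apply: eq_big => [S|S].
    rewrite setU11 andbT subUset sub1set zA /= subsetD1.
    have [zS|zS] := boolP (z \in S).
      rewrite andbF /=; apply/negbTE/negP => /andP[_ /eqP E].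
      by move: zS; rewrite -E !inE eqxx.
    by rewrite setU1K // eqxx !andbT cardsU1 zS.
  rewrite setU11 andbT subUset sub1set zA /= => /andP[/andP[SA Sd] /eqP SE].
  have zS : z \notin S by rewrite -SE !inE eqxx.
  rewrite -exprD setDDl /cross big_setU1 //=; congr (q ^+ (_ + _)).
  have -> : [set j in A :\: (z |: S) | (rho j < rho z)%N] = (A :\ z) :\: S.
    apply/setP=> j; rewrite !inE negb_or.
    by case: eqP => //= /eqP jz; case: (j \in S) => //=; case: (boolP (j \in A)) => //= /ltz ->.
  rewrite cardsDS ?cardAz; last by rewrite subsetD1 SA.
  by move: Sd; rewrite cardsU1 zS add1n eqSS => /eqP ->.
rewrite -(IH (A :\ z)) //; apply: eq_big => [S|S /andP[/andP[SA _] zS]].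
  by rewrite subsetD1 -!andbA [(z \notin S) && _]andbC.
congr (q ^+ _); apply: eq_bigr => i iS; congr #|pred_of_set _|; apply/setP => j.
rewrite !inE; have [->|//] := eqVneq j z.
by rewrite [(rho z < _)%N]ltnNge (zmax i) ?andbF //; apply: (subsetP SA).
Qed.

End SubsetInversions.

(** * Inversions of words, with one order of the positions per letter *)

Section WordInversions.

Variables (F : fieldType) (q : F) (T : finType) (t : nat).
Variables (d : 'I_t -> nat) (rho : 'I_t -> T -> nat).
Hypothesis rho_inj : forall k, injective (rho k).
Implicit Types (A S : {set T}) (f g : {ffun T -> 'I_t}).

(** Two positions are compared in the order attached to the smaller of their letters. If all the
    orders agree, these are the usual inversions of a word. *)
Definition word_inv A f : nat :=
  (\sum_(i in A) #|[set j in A | (f i < f j) && (rho (f i) j < rho (f i) i)]|)%N.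

(* The values outside A are prescribed by g, so that fixing the fiber of the
   smallest letter yields a set of words of the same form. *)
Definition words_on (m : nat) A g : pred {ffun T -> 'I_t} := fun f =>
  [forall x, if x \in A then m <= f x else f x == g x]%N
  && [forall k : 'I_t, (m <= k) ==> (#|[set x in A | f x == k]| == d k)]%N.

(** Peels off the letter [k]: recording it on [S] in the prescribed values keeps the same functions
    [f], with no change of domain. *)
Lemma words_on_fiber (k : 'I_t) A g f S : S \subset A -> #|S| = d k ->
  words_on k A g f && ([set x in A | f x == k] == S)
  = words_on k.+1 (A :\: S) [ffun x => if x \in S then k else g x] f.
Proof.
move=> SA Sd; apply/andP/andP => [[/andP[/forallP fA /forallP cnt] /eqP SE]|].
  split; [apply/forallP => x|apply/forallP => l].
    move: (fA x); rewrite ffunE -SE !inE; case: (x \in A) => //=.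
    by case: (eqVneq (f x) k) => [->|] //=; rewrite -val_eqE ltn_neqAle eq_sym => -> ->.
  apply/implyP => kl; move/implyP: (cnt l) => /(_ (ltnW kl)) /eqP <-.
  apply/eqP/eq_card => x; rewrite -SE !inE.
  case: (x \in A) => //=; rewrite ?andbF ?andbT //.
  by case: (eqVneq (f x) l) => [->|]; rewrite ?andbF // -val_eqE gtn_eqF.
move=> [/forallP fA /forallP cnt].
have SE : [set x in A | f x == k] = S.
  apply/setP => x; move: (fA x); rewrite !inE ffunE.
  have [xS|xS] /= := boolP (x \in S); first by rewrite (subsetP SA).
  by case: (x \in A) => //= kx; apply/negbTE; rewrite -val_eqE gtn_eqF.
split; last exact/eqP.
apply/andP; split; [apply/forallP => x|apply/forallP => l].
  move: (fA x); rewrite !inE ffunE.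
  have [xS /eqP ->|xS] /= := boolP (x \in S); first by rewrite (subsetP SA) /=.
  by case: (x \in A) => // /ltnW.
apply/implyP; rewrite leq_eqVlt => /orP[/eqP/val_inj <-|kl]; first by rewrite SE Sd.
move/implyP: (cnt l) => /(_ kl) /eqP <-; apply/eqP/eq_card => x; rewrite -SE !inE.
case: (x \in A) => //=; rewrite ?andbF ?andbT //.
by case: (eqVneq (f x) l) => [->|]; rewrite ?andbF // -val_eqE gtn_eqF.
Qed.

(** As [k] is the least letter on [A], an inversion whose smaller letter is [k] joins [S] to its
    complement, and every other one lies outside [S]. *)
Lemma word_inv_fiber (k : 'I_t) A g f :
  let S := [set x in A | f x == k] in words_on k A g f ->
  word_inv A f = (cross (rho k) S (A :\: S) + word_inv (A :\: S) f)%N.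
Proof.
move=> S /andP[/forallP fA _]; rewrite /word_inv (big_setID S) /=.
have leA x : x \in A -> (k <= f x)%N by move=> xA; move: (fA x); rewrite xA.
congr (_ + _)%N.
  rewrite (setIidPr _); last by apply/subsetP => x; rewrite !inE => /andP[].
  apply: eq_bigr => i; rewrite inE => /andP[iA /eqP ->].
  apply: eq_card => j; rewrite !inE andbA; congr (_ && _).
  rewrite andbC; case: (boolP (j \in A)) => /= jA; rewrite ?andbF ?andbT //.
  by rewrite -val_eqE ltn_neqAle leA // andbT eq_sym.
apply: eq_bigr => i; rewrite !inE => /andP[fi iA]; rewrite iA /= in fi.
apply: eq_card => j; rewrite !inE.
case: (boolP (j \in A)) => /= jA; rewrite ?andbF // andbT.
by case: (eqVneq (f j) k) => //= ->; rewrite ltnNge leA.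
Qed.

(** Induction on the number [t - m] of remaining letters. Once the fiber [S] of the letter [m] is
    fixed, the sum over the rest depends only on the size of [A :\: S], so [rho m] enters only
    through [sum_cross]. *)
Lemma sum_word_inv m A g : (m <= t)%N ->
  #|A| = (\sum_(k < t | m <= k) d k)%N ->
  (\sum_(f | words_on m A g f) q ^+ word_inv A f)
    * \prod_(k < t | (m <= k)%N) qfact q (d k) = qfact q #|A|.
Proof.
move=> le_mt; move sE : (t - m)%N => s; elim: s => [|s IH] in m A g le_mt sE *.
  have mE : m = t by lia.
  have no_letter (k : 'I_t) : (m <= k)%N = false by rewrite mE leqNgt ltn_ord.
  rewrite !(big_pred0 _ _ _ _ no_letter).
  move/eqP => cA; rewrite (eqP cA) qfact0 mulr1.
  move: cA; rewrite cards_eq0 => /eqP ->.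
  rewrite (big_pred1 g) => [|f]; first by rewrite /word_inv big_set0.
  apply/andP/eqP => [[/forallP fg _]|->].
    by apply/ffunP => x; apply/eqP; move: (fg x); rewrite inE.
  by split; apply/forallP => x; rewrite ?inE ?no_letter.
have lt_mt : (m < t)%N by lia.
pose k := Ordinal lt_mt.
have split_ge (l : 'I_t) : ((m <= l) && (l != k) = (m < l))%N.
  by rewrite andbC ltn_neqAle -val_eqE eq_sym.
rewrite (bigD1 k) //= (eq_bigl _ _ split_ge) => cA.
rewrite (bigD1 k) //= (eq_bigl _ _ split_ge).
rewrite (partition_big (fun f => [set x in A | f x == k])
  (fun S => (S \subset A) && (#|S| == d k))) /=; last first.
  move=> f /andP[_ /forallP/(_ k)]; rewrite leqnn /= => ->.
  by rewrite andbT; apply/subsetP => x; rewrite inE => /andP[].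
have le_dA : (d k <= #|A|)%N by rewrite cA leq_addr.
(* Expanding the binomial factor of [[#|A|]!] as a sum over [S] allows a comparison term by term. *)
rewrite -(qbinom_fact q le_dA) -(sum_cross q A (d k) (@rho_inj k)) !mulr_suml.
apply: eq_bigr => S /andP[SA /eqP Sd].
have cAS : #|A :\: S| = (#|A| - d k)%N by rewrite cardsDS // Sd.
rewrite -cAS -(IH m.+1 (A :\: S) [ffun x => if x \in S then k else g x]) //;
  [|lia|by rewrite cAS cA addKn].
rewrite -(eq_bigl _ _ (fun f => @words_on_fiber k A g f S SA Sd)).
set X := \sum_(f | _) _; set Y := \sum_(f | _) _.
suff -> : X = q ^+ cross (rho k) S (A :\: S) * Y by ring.
rewrite /X /Y big_distrr /=; apply: eq_bigr => f /andP[fW /eqP SE].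
by rewrite -exprD (@word_inv_fiber k _ _ _ fW) SE.
Qed.

End WordInversions.

(** * Circles as word inversions *)

Section DworkinStatistic.

Variables (n t : nat) (d h : 'I_t -> nat).

Local Notation B := (ferrers_board n d h).

(** Encodes the cyclic order of the rows: ranks are at most [n] on the board and above [n] off it,
    and decrease with [i] on each side. *)
Definition row_rank (k : 'I_t) (i : 'I_n) : nat :=
  if (i < \sum_(l < t | l <= k) h l)%N then (n - i)%N else (n + n - i)%N.

Lemma row_rank_inj k : injective (row_rank k).
Proof.
move=> i j; rewrite /row_rank => E; apply: val_inj => /=; move: E.
by have := ltn_ord i; have := ltn_ord j; do 2!case: ifP; lia.
Qed.

Lemma xi_columns (C : 'S_n) :
  xi B C = (\sum_i #|[set j | circled B C (j, C i)]|)%N.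
Proof.
rewrite /xi cardsE -sum1_card big_mkcond /=.
rewrite (eq_bigr (fun x => (fun j i => nat_of_bool (circled B C (j, i))) x.1 x.2));
  last by case=> j i _; rewrite unfold_in.
rewrite -(pair_bigA _ (fun j i => nat_of_bool (circled B C (j, i)))) /= exchange_big /=.
rewrite (reindex_perm C) /=; apply: eq_bigr => i _.
rewrite -sum1_card [RHS]big_mkcond /=; apply: eq_bigr => j _.
by rewrite inE; case: circled.
Qed.

Hypothesis nE : n = (\sum_(i < t) d i)%N.

(** A circle in row [j] under the rook of row [i] needs [C i < C j] and a smaller rank for [j].
    Between distinct letters the blocks decide the first condition; within a block regularity
    contradicts it. *)
Lemma xi_word_inv (sigma : n.-tuple 'I_t) : sigma \in multiset_perms n d ->
  xi_word d B sigma = word_inv row_rank setT [ffun i => tnth sigma i].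
Proof.
move=> sP; rewrite /xi_word; set C := regular_graph _ _ _.
have Creg : is_regular_graph d B sigma C by apply: regular_graphP.
have Cb i : C i \in block n d (tnth sigma i) by case/andP: Creg => /forallP.
rewrite xi_columns /word_inv; apply: eq_big => [i|i _]; first by rewrite inE.
apply: eq_card => j; rewrite !inE /= !ffunE.
rewrite /circled /empty_cell permK /rook_on /= !(on_board _ _ (Cb i)).
set w := tnth sigma in Cb *.
(* Both cases of the circling rule amount to preceding the rook in the cyclic order. *)
have rankE : (if (i < \sum_(l < t | l <= w i) h l)%N
    then (j < \sum_(l < t | l <= w i) h l)%N && (i < j)%N
    else (i < j)%N || (j < \sum_(l < t | l <= w i) h l)%N && (j < i)%N)
    = (row_rank (w i) j < row_rank (w i) i)%N.
  by rewrite /row_rank; have := ltn_ord i; have := ltn_ord j; do 2!case: ifP; lia.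
rewrite rankE; have [ltr|] := boolP (row_rank _ _ < _)%N; last by rewrite !andbF.
rewrite !andbT -leqNgt.
have -> : (C i != C j) && (C i <= C j)%N = (C i < C j)%N by rewrite -val_eqE ltn_neqAle.
have blockP l : (\sum_(m < t | m < w l) d m <= C l
    < \sum_(m < t | m < w l) d m + d (w l))%N by rewrite -(in_block d).
have blk a b : (w a < w b)%N -> (C a < C b)%N.
  move/(off_mono d) => le; case/andP: (blockP a) => _ lt1.
  by case/andP: (blockP b) => le2 _; apply: leq_trans lt1 (leq_trans le le2).
case: (ltngtP (w i) (w j)) => [/blk //|/blk/ltnW|/val_inj wE].
  by rewrite leqNgt => /negbTE.
(* Within a block, a smaller rank means a rook further left. *)
apply/negbTE; rewrite -leqNgt ltnW //; apply: (regular_mono Creg (esym wE)).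
rewrite -/w -wE; move: ltr; rewrite /row_rank.
by have := ltn_ord i; have := ltn_ord j; do 2!case: ifP; rewrite /=; lia.
Qed.

End DworkinStatistic.

(** * Nonvanishing in Q(q) and conclusion *)

Lemma qint_qvar_neq0 m : qint qvar m.+1 != 0.
Proof.
(* The polynomials [X^k] and 1 differ in size; [k = 1] serves for the denominator of [qint]. *)
have qX k : (0 < k)%N -> 1 - qvar ^+ k != 0.
  move=> k_gt0; rewrite subr_eq0 /qvar -tofracXn -tofrac1.
  rewrite tofrac_eq; apply/eqP => /(congr1 (fun p : {poly rat} => size p)).
  by rewrite size_polyXn size_poly1; lia.
by rewrite /qint mulf_neq0 ?invr_eq0 ?qX // -[qvar]expr1 qX.
Qed.

Lemma qfact_qvar_neq0 m : qfact qvar m != 0.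
Proof.
elim: m => [|m IH]; first by rewrite qfact0 oner_eq0.
by rewrite qfactS mulf_neq0 ?qint_qvar_neq0.
Qed.

Theorem theorem4 (n t : nat) (d h : 'I_t -> nat) (ht : (0 < t)%N)
    (hd : forall i, (0 < d i)%N) (hn : n = (\sum_(i < t) d i)%N)
    (hh : (\sum_(i < t) h i <= n)%N) :
  \sum_(sigma in multiset_perms n d)
      qvar ^+ xi_word d (ferrers_board n d h) sigma
  = qfact qvar n / \prod_(i < t) qfact qvar (d i).
Proof.
pose word (f : {ffun 'I_n -> 'I_t}) : n.-tuple 'I_t := [tuple f i | i < n].
pose ffun_of (sigma : n.-tuple 'I_t) := [ffun i => tnth sigma i].
have wordK : cancel word ffun_of by move=> f; apply/ffunP => i; rewrite ffunE tnth_mktuple.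
have ffunK : cancel ffun_of word by move=> s; apply: eq_from_tnth => i; rewrite tnth_mktuple ffunE.
(* An arbitrary choice: on the full set of rows no value is prescribed. *)
pose g : {ffun 'I_n -> 'I_t} := [ffun=> Ordinal ht].
have cT : #|[set: 'I_n]| = (\sum_(k < t | 0 <= k) d k)%N by rewrite cardsT card_ord.
have := sum_word_inv qvar (row_rank_inj (h := h)) g (leq0n t) cT.
rewrite cardsT card_ord => <-.
rewrite mulfK; last by apply/prodf_neq0 => k _; apply: qfact_qvar_neq0.
rewrite (reindex word); last by exists ffun_of => f _; [apply: wordK | apply: ffunK].
apply: eq_big => [f|f fP]; last by rewrite xi_word_inv // -/(ffun_of _) wordK.
rewrite inE [RHS]andb_idl; last by move=> _; apply/forallP => x; rewrite inE.
apply: eq_forallb => k; congr (_ == _).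
rewrite cardsE -sum1_count -sum1_card big_tuple; apply: eq_bigl => i.
by rewrite unfold_in tnth_mktuple in_setT.
Qed.
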